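(* If the 2-sequent $\Gamma\vdash\Delta$ is derivable in $2^i_{\mathsf{LTL}}$, then $\Gamma\models_{2_{\mathsf{LTL}}}\Delta$.
   Context: Temporal formulas are built from proposition symbols (set $At$) using $\neg,\wedge,\vee,\to$ and the unary operators $\Box,\Diamond,\bigcirc$ (always, sometime, next). Positions are pairs $\langle n,S\rangle$ with $n\in\mathbb N$ and $S$ a finite set of tokens from a countably infinite set $T$. For $s=\langle n,S\rangle$, $t=\langle m,T'\rangle$: $s\oplus t=\langle n+m,S\cup T'\rangle$; $s\oplus m$ means $s\oplus\langle m,\varnothing\rangle$; $s\oplus x$ means $s\oplus\langle 0,\{x\}\rangle$. A p-formula is $A^s$; a 2-sequent is $\Gamma\vdash\Delta$ with $\Gamma,\Delta$ finite sequences of p-formulas; $x\notin s,\Gamma,\Delta$ means the token $x$ belongs to no position in $s,\Gamma,\Delta$. The calculus $2^i_{\mathsf{LTL}}$: Axiom $A^s\vdash A^s$; unrestricted Cut; weakening, contraction, exchange; classical propositional sequent rules for $\neg,\wedge,\vee,\to$ with all active p-formulas at the same position; temporal rules: from $\Gamma,A^{s\oplus t}\vdash\Delta$ infer $\Gamma,(\Box A)^s\vdash\Delta$ ($t$ any position); from $\Gamma\vdash A^{s\oplus x},\Delta$ infer $\Gamma\vdash(\Box A)^s,\Delta$; from $\Gamma,A^{s\oplus x}\vdash\Delta$ infer $\Gamma,(\Diamond A)^s\vdash\Delta$; from $\Gamma\vdash A^{s\oplus t},\Delta$ infer $\Gamma\vdash(\Diamond A)^s,\Delta$; from $\Gamma,A^{s\oplus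 1}\vdash\Delta$ infer $\Gamma,(\bigcirc A)^s\vdash\Delta$; from $\Gamma\vdash A^{s\oplus1},\Delta$ infer $\Gamma\vdash(\bigcirc A)^s,\Delta$; with $x\notin s,\Gamma,\Delta$ in the right $\Box$ and left $\Diamond$ rules; and, for every formula $A$ and position $s$, the axiom $\vdash(A\wedge\Box(A\to\bigcirc A)\to\Box A)^s$. Semantics: for $v:\mathbb N\to 2^{At}$ and $m\in\mathbb N$, $\mathbb N_v\models_m A$ is the standard satisfaction: $p$ holds iff $p\in v(m)$, Boolean clauses as usual, $\mathbb N_v\models_m\Box B$ iff $\mathbb N_v\models_k B$ for all $k\ge m$, $\mathbb N_v\models_m\Diamond B$ iff $\mathbb N_v\models_k B$ for some $k\ge m$, $\mathbb N_v\models_m\bigcirc B$ iff $\mathbb N_v\models_{m+1}B$. For $a:T\to\mathbb N$, set $a(\langle n,S\rangle)=n+\sum_{x\in S}a(x)$, and $\mathbb N_{a,v}\models A^s$ iff $\mathbb N_v\models_{a(s)}A$. $\mathbb N_{a,v}\models\Gamma\vdash\Delta$ iff, whenever all p-formulas of $\Gamma$ hold in $\mathbb N_{a,v}$, some p-formula of $\Delta$ holds. $\Gamma\models_{2_{\mathsf{LTL}}}\Delta$ iff $\mathbb N_{a,v}\models\Gamma\vdash\Delta$ for all $a$ and $v$. *)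

(* Defs.v *)
From Stdlib Require List.
From mathcomp Require Import all_boot finmap.

Set Implicit Arguments.
Unset Strict Implicit.
Unset Printing Implicit Defensive.

Local Open Scope fset_scope.
Local Open Scope nat_scope.

Declare Scope tl_scope.
Delimit Scope tl_scope with tl.

Inductive formula (At : Type) : Type :=
| Atom of At
| Neg of formula At
| And of formula At & formula At
| Or of formula At & formula At
| Imp of formula At & formula At
| Box of formula At
| Dia of formula At
| Next of formula At.

Bind Scope tl_scope with formula.
Notation "¬ A" := (Neg A) (at level 35, right associativity) : tl_scope.
Notation "□ A" := (Box A) (at level 35, right associativity) : tl_scope.
Notation "◇ A" := (Dia A) (at level 35, right associativity) : tl_scope.
Notation "○ A" := (Next A) (at level 35, right associativity) : tl_scope.
Notation "A ∧ B" := (And A B) (at level 80, right associativity) : tl_scope.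
Notation "A ∨ B" := (Or A B) (at level 85, right associativity) : tl_scope.
Notation "A → B" := (Imp A B) (at level 99, right associativity) : tl_scope.

Definition position (T : choiceType) : Type := (nat * {fset T})%type.

Definition oplus (T : choiceType) (s t : position T) : position T :=
  (s.1 + t.1, s.2 `|` t.2).

Definition oplus_nat (T : choiceType) (s : position T) (m : nat) : position T :=
  oplus s (m, fset0).

Definition oplus_tok (T : choiceType) (s : position T) (x : T) : position T :=
  oplus s (0, [fset x]).

Notation "s ⊕ t" := (oplus s t) (at level 50, left associativity) : tl_scope.
Notation "s ⊕ₙ m" := (oplus_nat s m) (at level 50, left associativity) : tl_scope.
Notation "s ⊕ₓ x" := (oplus_tok s x) (at level 50, left associativity) : tl_scope.

Record pformula (At : Type) (T : choiceType) : Type :=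
  PFormula { pform : formula At; ppos : position T }.

Notation "A '@[' s ]" := (PFormula A%tl s%tl)
  (at level 8, left associativity, format "A '@[' s ]") : tl_scope.

Definition fresh_pos (T : choiceType) (x : T) (s : position T) : Prop :=
  x \notin s.2.

Definition fresh_seq (At : Type) (T : choiceType) (x : T)
    (G : seq (pformula At T)) : Prop :=
  List.Forall (fun F => fresh_pos x (ppos F)) G.

Reserved Notation "G ⊢ D" (at level 101, no associativity).

Local Open Scope tl_scope.

(* Antecedents are extended on the right and succedents on the left, so that
   active p-formulas sit next to the turnstile.  The propositional and structural
   rules, including the choice between shared and split contexts, are those of
   Gentzen's LK. *)
Inductive derivable (At : Type) (T : choiceType) :
    seq (pformula At T) -> seq (pformula At T) -> Prop :=
| d_ax A s : [:: A@[s]] ⊢ [:: A@[s]]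
| d_cut A s G1 D1 G2 D2 :
    (G1 ⊢ A@[s] :: D1) -> (rcons G2 A@[s] ⊢ D2) -> G1 ++ G2 ⊢ D1 ++ D2
| d_weakL A s G D : (G ⊢ D) -> rcons G A@[s] ⊢ D
| d_weakR A s G D : (G ⊢ D) -> G ⊢ A@[s] :: D
| d_contrL A s G D :
    (rcons (rcons G A@[s]) A@[s] ⊢ D) -> rcons G A@[s] ⊢ D
| d_contrR A s G D :
    (G ⊢ A@[s] :: A@[s] :: D) -> G ⊢ A@[s] :: D
| d_exchL A s B t G1 G2 D :
    (G1 ++ A@[s] :: B@[t] :: G2 ⊢ D) -> G1 ++ B@[t] :: A@[s] :: G2 ⊢ D
| d_exchR A s B t G D1 D2 :
    (G ⊢ D1 ++ A@[s] :: B@[t] :: D2) -> G ⊢ D1 ++ B@[t] :: A@[s] :: D2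
| d_negL A s G D : (G ⊢ A@[s] :: D) -> rcons G (¬ A)@[s] ⊢ D
| d_negR A s G D : (rcons G A@[s] ⊢ D) -> G ⊢ (¬ A)@[s] :: D
| d_andL1 A B s G D : (rcons G A@[s] ⊢ D) -> rcons G (A ∧ B)@[s] ⊢ D
| d_andL2 A B s G D : (rcons G B@[s] ⊢ D) -> rcons G (A ∧ B)@[s] ⊢ D
| d_andR A B s G D :
    (G ⊢ A@[s] :: D) -> (G ⊢ B@[s] :: D) -> G ⊢ (A ∧ B)@[s] :: D
| d_orL A B s G D :
    (rcons G A@[s] ⊢ D) -> (rcons G B@[s] ⊢ D) -> rcons G (A ∨ B)@[s] ⊢ D
| d_orR1 A B s G D : (G ⊢ A@[s] :: D) -> G ⊢ (A ∨ B)@[s] :: D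
| d_orR2 A B s G D : (G ⊢ B@[s] :: D) -> G ⊢ (A ∨ B)@[s] :: D
| d_impL A B s G1 D1 G2 D2 :
    (G1 ⊢ A@[s] :: D1) -> (rcons G2 B@[s] ⊢ D2) ->
    rcons (G1 ++ G2) (A → B)@[s] ⊢ D1 ++ D2
| d_impR A B s G D : (rcons G A@[s] ⊢ B@[s] :: D) -> G ⊢ (A → B)@[s] :: D
| d_boxL A s t G D : (rcons G A@[s ⊕ t] ⊢ D) -> rcons G (□ A)@[s] ⊢ D
| d_boxR A s x G D :
    fresh_pos x s -> fresh_seq x G -> fresh_seq x D ->
    (G ⊢ A@[s ⊕ₓ x] :: D) -> G ⊢ (□ A)@[s] :: D
| d_diaL A s x G D :
    fresh_pos x s -> fresh_seq x G -> fresh_seq x D ->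
    (rcons G A@[s ⊕ₓ x] ⊢ D) -> rcons G (◇ A)@[s] ⊢ D
| d_diaR A s t G D : (G ⊢ A@[s ⊕ t] :: D) -> G ⊢ (◇ A)@[s] :: D
| d_nextL A s G D : (rcons G A@[s ⊕ₙ 1] ⊢ D) -> rcons G (○ A)@[s] ⊢ D
| d_nextR A s G D : (G ⊢ A@[s ⊕ₙ 1] :: D) -> G ⊢ (○ A)@[s] :: D
| d_ind A s : [::] ⊢ [:: (A ∧ □ (A → ○ A) → □ A)@[s]]
where "G ⊢ D" := (derivable G D).

(* The subset v n of At is represented by its membership predicate. *)
Fixpoint sat (At : Type) (v : nat -> At -> Prop) (m : nat) (A : formula At)
    : Prop :=
  match A with
  | Atom p => v m p
  | Neg B => ~ sat v m B
  | And B C => sat v m B /\ sat v m C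
  | Or B C => sat v m B \/ sat v m C
  | Imp B C => sat v m B -> sat v m C
  | Box B => forall k : nat, m <= k -> sat v k B
  | Dia B => exists2 k : nat, m <= k & sat v k B
  | Next B => sat v m.+1 B
  end.

Definition eval_pos (T : choiceType) (a : T -> nat) (s : position T) : nat :=
  s.1 + \sum_(x <- s.2) a x.

Definition psat (At : Type) (T : choiceType) (a : T -> nat)
    (v : nat -> At -> Prop) (F : pformula At T) : Prop :=
  sat v (eval_pos a (ppos F)) (pform F).

Definition sat_sequent (At : Type) (T : choiceType) (a : T -> nat)
    (v : nat -> At -> Prop) (G D : seq (pformula At T)) : Prop :=
  List.Forall (psat a v) G -> List.Exists (psat a v) D.

Definition entails (At : Type) (T : choiceType)
    (G D : seq (pformula At T)) : Prop :=
  forall (a : T -> nat) (v : nat -> At -> Prop), sat_sequent a v G D.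

(* Main.v *)
(** Soundness of each rule is checked at a fixed valuation, except for the two
    rules with an eigentoken: there the token [x] is reassigned the value
    [k - a(s)], so that [s ⊕ x] denotes an arbitrary [k >= a(s)], and freshness
    makes the side formulas insensitive to the change. *)
Require Import Defs.
From Stdlib Require Import Classical.
From Stdlib Require List.
From mathcomp Require Import all_boot finmap.

Set Implicit Arguments.
Unset Strict Implicit.
Unset Printing Implicit Defensive.

Local Open Scope nat_scope.

Lemma Forall_rcons (X : Type) (P : X -> Prop) (s : seq X) (x : X) :
  List.Forall P (rcons s x) <-> List.Forall P s /\ P x.
Proof.
rewrite -cats1; split=> [/List.Forall_app [? /List.Forall_cons_iff [? _]]|[? ?]] //.
by apply/List.Forall_app; split=> //; constructor.
Qed.

Section EvalPos.
Variables (T : choiceType) (a : T -> nat).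
Implicit Types (s t : position T) (x : T).

(** A token common to [s] and [t] is counted only once in the union, so evaluation is not additive
    on [⊕]. Monotonicity survives, and it suffices for □-left and ◇-right. *)
Lemma leq_eval_pos_oplus s t : eval_pos a s <= eval_pos a (oplus s t).
Proof.
rewrite /eval_pos /=; apply: leq_add; first exact: leq_addr.
apply: uniq_sub_le_big (fset_uniq _) (fset_uniq _) _ => // [? ?|x xs].
  exact: leq_addr.
by rewrite inE xs.
Qed.

Lemma eval_pos_oplus_nat s m : eval_pos a (oplus_nat s m) = eval_pos a s + m.
Proof. by rewrite /eval_pos /= fsetU0 addnAC. Qed.

(** Freshness makes the union with [[fset x]] disjoint, so no token is merged and the values do add
    up. *)
Lemma eval_pos_oplus_tok s x :
  fresh_pos x s -> eval_pos a (oplus_tok s x) = eval_pos a s + a x.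
Proof.
move=> xs; rewrite /eval_pos /= addn0 fsetUC big_fsetU1 //=.
by rewrite addnA addnAC.
Qed.

Lemma eval_pos_fresh x k s :
  fresh_pos x s -> eval_pos [eta a with x |-> k] s = eval_pos a s.
Proof.
move=> xs; congr addn; apply: eq_big_seq => y ys /=.
by case: eqP ys xs => // -> ys; rewrite /fresh_pos ys.
Qed.

End EvalPos.

(** The difference is truncated subtraction, so the bound on [k] is what lets it cancel. *)
Lemma eval_pos_fresh_tok (T : choiceType) (a : T -> nat) x k (s : position T) :
    fresh_pos x s -> eval_pos a s <= k ->
  eval_pos [eta a with x |-> k - eval_pos a s] (oplus_tok s x) = k.
Proof.
by move=> xs le_k; rewrite eval_pos_oplus_tok // eval_pos_fresh //= eqxx subnKC.
Qed.

Section Satisfaction.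
Variables (At : Type) (T : choiceType).
Variables (a : T -> nat) (v : nat -> At -> Prop).
Implicit Types (A : formula At) (F : pformula At T) (G D : seq (pformula At T)).

Lemma psat_fresh x k F :
  fresh_pos x (ppos F) -> psat [eta a with x |-> k] v F <-> psat a v F.
Proof. by move=> xF; rewrite /psat eval_pos_fresh. Qed.

Lemma Forall_psat_fresh x k G :
    fresh_seq x G ->
  List.Forall (psat [eta a with x |-> k] v) G <-> List.Forall (psat a v) G.
Proof.
by elim=> [//|F {}G xF _ IH]; rewrite !List.Forall_cons_iff IH psat_fresh.
Qed.

Lemma Exists_psat_fresh x k D :
    fresh_seq x D ->
  List.Exists (psat [eta a with x |-> k] v) D <-> List.Exists (psat a v) D.
Proof.
elim=> [|F {}D xF _ IH]; first by rewrite !List.Exists_nil.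
by rewrite !List.Exists_cons IH psat_fresh.
Qed.

(** Semantic content of the induction axiom: ordinary induction on the distance [k - m]. *)
Lemma sat_induction m A :
    sat v m A -> (forall k, m <= k -> sat v k A -> sat v k.+1 A) ->
  forall k, m <= k -> sat v k A.
Proof.
move=> Am step k /subnKC <-; elim: (k - m) => [|i IH]; first by rewrite addn0.
by rewrite addnS; apply: step => //; apply: leq_addr.
Qed.

End Satisfaction.

Theorem mainTheorem17 (At : Type) (T : choiceType)
    (hT : exists f : nat -> T, bijective f)
    (Gamma Delta : seq (pformula At T)) :
  derivable Gamma Delta -> entails Gamma Delta.
Proof.
rewrite /entails /sat_sequent.
elim=> {Gamma Delta}
  [A s|A s G1 D1 G2 D2 _ IH1 _ IH2|A s G D _ IH|A s G D _ IH|A s G D _ IH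
  |A s G D _ IH|A s B t G1 G2 D _ IH|A s B t G D1 D2 _ IH|A s G D _ IH
  |A s G D _ IH|A B s G D _ IH|A B s G D _ IH|A B s G D _ IH1 _ IH2
  |A B s G D _ IH1 _ IH2|A B s G D _ IH|A B s G D _ IH
  |A B s G1 D1 G2 D2 _ IH1 _ IH2|A B s G D _ IH|A s t G D _ IH
  |A s x G D xs xG xD _ IH|A s x G D xs xG xD _ IH|A s t G D _ IH
  |A s G D _ IH|A s G D _ IH|A s] a v;
  (* Only instances are pushed to the goal; the general [IH] stays in context for the eigentoken
     rules, which use it at a modified assignment. *)
  try move: (IH a v); try move: (IH1 a v) (IH2 a v);
  rewrite ?(Forall_rcons, List.Forall_cons_iff, List.Forall_app,
            List.Exists_cons, List.Exists_app);
  (* With [Classical] loaded, [tauto] is classical: needed for the right rules of ¬ and →. *)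
  try by rewrite /psat /=; tauto.
- move=> H [HG HA]; apply: H; split=> //.
  exact/HA/leq_eval_pos_oplus.
(* □-right: [IH] gives a disjunction for each [k] separately, so whether [D] holds is decided once,
   before [k] is chosen. *)
- move=> _ HG; have [|nD] := classic (List.Exists (psat a v) D); first by right.
  left=> k /= le_k.
  have := IH [eta a with x |-> k - eval_pos a s] v.
  rewrite Forall_psat_fresh // List.Exists_cons Exists_psat_fresh //.
  by rewrite /psat /= eval_pos_fresh_tok // => /(_ HG) [].
(* ◇-left: a single reassignment is enough, with [k] the witness of the diamond. *)
- move=> _ [HG [k /= le_k Ak]].
  have := IH [eta a with x |-> k - eval_pos a s] v.
  rewrite Forall_rcons Forall_psat_fresh // Exists_psat_fresh //.
  by rewrite /psat /= eval_pos_fresh_tok //; apply.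
- move=> H /H [HA|]; last by right.
  by left; exists (eval_pos a (oplus s t)) => //; apply: leq_eval_pos_oplus.
- by rewrite /psat /= eval_pos_oplus_nat addn1.
- by rewrite /psat /= eval_pos_oplus_nat addn1.
- by move=> _; left=> -[A0 step]; apply: sat_induction A0 step.
Qed.
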